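(* Let $t \geq 2$ be an integer. There exists an integer $M = M(t)$ such that every graph with no odd $K_t$ minor is $(10t-13)$-colorable with clustering $M$. Equivalently, the clustered chromatic number of the class of graphs with no odd $K_t$ minor is at most $10t-13$.
   Context: All graphs are finite and simple. A graph $G$ contains a graph $H$ as an odd minor if there exist vertex-disjoint subgraphs $\{T_u\}_{u \in V(H)}$ of $G$, each of which is a tree, and a coloring $\alpha : \bigcup_{u \in V(H)} V(T_u) \to \{1,2\}$ such that for every $u \in V(H)$ every edge of $T_u$ is bichromatic (its ends receive different $\alpha$-values), and for every edge $vw \in E(H)$ there is a monochromatic edge of $G$ (its ends receive the same $\alpha$-value) joining $V(T_v)$ and $V(T_w)$. ''No odd $K_t$ minor'' means $G$ does not contain $K_t$ as an odd minor. For integers $k, M \ge 0$, a graph $G$ is $k$-colorable with clustering $M$ if there is a map $f: V(G) \to \{1,\dots,k\}$ such that each color class $f^{-1}(i)$ induces a subgraph in which every connected component has at most $M$ vertices. The clustered chromatic number of a class $\mathcal C$ is the minimum $k$ such that for some $M$ all graphs in $\mathcal C$ are $k$-colorable with clustering $M$. *)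

(* Defs.v *)
From mathcomp Require Import all_boot.
Set Implicit Arguments. Unset Strict Implicit. Unset Printing Implicit Defensive.

Definition simple_graph (T : finType) (e : rel T) : Prop :=
  symmetric e /\ irreflexive e.

(* (V, E) is a tree subgraph of the graph e: E is a symmetric set of edges of
   e with both ends in V, V is nonempty, (V, E) is connected, and it has
   exactly #|V| - 1 (undirected) edges, i.e. 2(#|V|-1) ordered pairs. *)
Definition tree_subgraph (T : finType) (e : rel T) (V : {set T}) (E : rel T)
  : Prop :=
  [/\ V != set0,
      forall x y, E x y -> [/\ e x y, E y x, x \in V & y \in V],
      forall x y, x \in V -> y \in V -> connect E x y
    & #|[set p : T * T | E p.1 p.2]| = (#|V| - 1).*2 ].

Definition odd_minor (T : finType) (e : rel T) (U : finType) (h : rel U)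
  : Prop :=
  exists (V : U -> {set T}) (E : U -> rel T) (alpha : T -> bool),
    [/\ forall u, tree_subgraph e (V u) (E u),
        forall u v, u != v -> [disjoint V u & V v],
        forall u x y, E u x y -> alpha x != alpha y
      & forall u v, h u v ->
          exists x y, [/\ x \in V u, y \in V v, e x y & alpha x = alpha y] ].

Definition complete_graph (t : nat) : rel 'I_t := fun i j => i != j.
Arguments complete_graph t : clear implicits.

(* f is a k-colouring (colours 'I_k) with clustering M: every connected
   component of every colour class has at most M vertices. The component
   of x in the subgraph induced by its colour class is the set of y reachable
   from x via edges both of whose ends have the colour of x. *)
Definition clustered_coloring (T : finType) (e : rel T) (k M : nat)
  (f : T -> 'I_k) : Prop :=
  forall x : T,
    #|[set y | connect (fun a b => [&& e a b, f a == f x & f b == f x]) x y]|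
      <= M.

Definition colorable_with_clustering (T : finType) (e : rel T) (k M : nat)
  : Prop := exists f : T -> 'I_k, clustered_coloring e M f.

(* Main.v *)
Require Import Defs.
From mathcomp Require Import all_boot.

(** Grow disjoint bichromatic trees B_c, one per colour c < t - 1, pairwise joined
    by a monochromatic edge and such that every uncoloured vertex with a
    neighbour in B_c has neighbours of both alpha-values in B_c. Given a connected
    uncoloured piece U, join a root of U to the neighbourhood of each B_c adjacent
    to U by geodesics of U, with alpha the parity of the distance to the root:
    monochromatic edges stay inside one distance layer, and each geodesic meets
    a layer at most once, so monochromatic components are bounded. Vertices of U
    all of whose neighbours in this tree have the same alpha-value are then
    absorbed with the other value, creating no monochromatic edge, until the new
    tree has the saturation property above. If all colours were adjacent to U,
    the trees would form an odd K_t minor; hence some colour is free for the new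
    tree, and the rest of U is coloured by induction. The pair (c, alpha) takes
    2(t - 1) <= 10t - 13 values. *)

Set Implicit Arguments.
Unset Strict Implicit.
Unset Printing Implicit Defensive.

(** * Bichromatic trees *)

Section OddMinorColoring.
Variables (T : finType) (e : rel T).
Hypothesis e_sym : symmetric e.

(** Only the vertex set is recorded, built leaf by leaf, so that growing a tree is one constructor;
    a matching edge set is recovered in [bichromatic_tree_subgraph]. *)
Inductive bichromatic_tree (alpha : T -> bool) : {set T} -> Prop :=
| BichromaticRoot x : bichromatic_tree alpha [set x]
| BichromaticLeaf B x y : bichromatic_tree alpha B -> x \in B -> y \notin B ->
    e x y -> alpha x != alpha y -> bichromatic_tree alpha (y |: B).

Lemma bichromatic_tree_neq0 alpha B : bichromatic_tree alpha B -> B != set0.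
Proof.
by case=> [x|{}B x y _ _ _ _ _]; apply/set0Pn; [exists x|exists y]; rewrite !inE eqxx.
Qed.

Lemma eq_bichromatic_tree alpha beta (B : {set T}) :
  (forall x, x \in B -> alpha x = beta x) ->
  bichromatic_tree alpha B -> bichromatic_tree beta B.
Proof.
move=> eqab tB; elim: tB eqab => [x|{}B x y tB IH xB yB exy axy] eqab.
  exact: BichromaticRoot.
apply: (@BichromaticLeaf _ _ x) => //.
  by apply: IH => z zB; apply: eqab; rewrite inE zB orbT.
by rewrite -!eqab ?inE ?eqxx ?xB ?orbT.
Qed.

Lemma bichromatic_tree_subgraph alpha B : bichromatic_tree alpha B ->
  exists2 E : rel T, tree_subgraph e B E & forall x y, E x y -> alpha x != alpha y.
Proof.
move=> tB; have := bichromatic_tree_neq0 tB.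
elim: tB => [x|{}B x y tB IH xB yB exy axy] B0.
  exists (fun _ _ => false) => //; split => //.
    by move=> y z /set1P -> /set1P ->; apply: connect0.
  rewrite cards1 subnn; apply: eq_card0 => p; by rewrite inE.
have [E [_ sub conn cardE] biE] := IH (bichromatic_tree_neq0 tB).
pose E' : rel T := fun a b =>
  [|| E a b, (a == x) && (b == y) | (a == y) && (b == x)].
have E'sym a b : E' a b -> E' b a.
  case/or3P => [Eab|/andP[/eqP-> /eqP->]|/andP[/eqP-> /eqP->]].
  - by apply/or3P; constructor 1; case: (sub _ _ Eab).
  - by rewrite /E' !eqxx !orbT.
  - by rewrite /E' !eqxx !orbT.
have connB a b : a \in B -> b \in B -> connect E' a b.
  move=> aB bB; apply: connect_sub (conn _ _ aB bB) => u v Euv.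
  by apply: connect1; rewrite /E' Euv.
have E'xy : E' x y by rewrite /E' !eqxx orbT.
have connx a : a \in y |: B -> connect E' a x.
  case/setU1P => [->|aB]; last exact: connB.
  by apply: connect1; apply: E'sym.
have xconn a : a \in y |: B -> connect E' x a.
  by case/setU1P => [->|aB]; [apply: connect1|apply: connB].
exists E'; last first.
  move=> a b /or3P[/biE //|/andP[/eqP-> /eqP->] //|/andP[/eqP-> /eqP->]].
  by rewrite eq_sym.
split=> //.
- move=> a b E'ab; split; [|exact: E'sym| |].
  + case/or3P: E'ab => [/sub[] //|/andP[/eqP-> /eqP->] //|/andP[/eqP-> /eqP->]].
    by rewrite e_sym.
  + case/or3P: E'ab => [/sub[_ _ aB _]|/andP[/eqP-> _]|/andP[/eqP-> _]];
      by rewrite inE ?aB ?xB ?inE ?eqxx ?orbT.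
  + case/or3P: E'ab => [/sub[_ _ _ bB]|/andP[_ /eqP->]|/andP[_ /eqP->]];
      by rewrite inE ?bB ?xB ?inE ?eqxx ?orbT.
- by move=> a b aB bB; apply: connect_trans (connx _ aB) (xconn _ bB).
have -> : [set p | E' p.1 p.2]
    = [set p | E p.1 p.2] :|: [set (x, y); (y, x)].
  by apply/setP=> -[a b]; rewrite !inE /E' !xpair_eqE.
have nyx : (x, y) != (y, x).
  by apply: contra yB; rewrite xpair_eqE => /andP[/eqP<-].
(* The two ordered pairs of the new edge are not in [E], since [y] lies outside [B]; each leaf thus
   adds exactly 2 to the count. *)
rewrite cardsU (_ : _ :&: _ = set0) ?cards0 ?subn0; last first.
  apply/setP=> -[a b]; rewrite !inE /= !xpair_eqE.
  apply/negP => /andP[/sub[_ _ aB bB]] /orP[]/andP[/eqP ? /eqP ?]; subst a b.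
    by rewrite bB in yB.
  by rewrite aB in yB.
rewrite cardE cards2 nyx cardsU1 yB add1n subn1 /=.
have : 0 < #|B| by rewrite card_gt0 (bichromatic_tree_neq0 tB).
by case: #|B| => // n _; rewrite subn1 /= addn2 doubleS.
Qed.

(** A vertex other than [u0] with [d] maximal is nobody's parent, so it can be removed as a leaf and
    the other vertices keep their parents. *)
Lemma bichromatic_tree_of_parents alpha (d : T -> nat) (u0 : T) (B : {set T}) :
  u0 \in B ->
  (forall v, v \in B -> v != u0 ->
     exists w, [/\ w \in B, e w v, d w < d v & alpha w != alpha v]) ->
  bichromatic_tree alpha B.
Proof.
have [n] := ubnP #|B|; elim: n B => // n IH B cardB u0B parB.
have [B0|[v1]] := set_0Vmem (B :\ u0).
  suff -> : B = [set u0] by apply: BichromaticRoot.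
  by rewrite -(setD1K u0B) B0 setU0.
move=> v1B; case: (arg_maxnP d v1B) => v /setD1P[vu0 vB] vmax {v1 v1B}.
have [w [wB ewv dwv awv]] := parB _ vB vu0.
have wv : w != v by apply: contraTneq dwv => ->; rewrite ltnn.
rewrite -(setD1K vB); apply: (@BichromaticLeaf _ _ w) => //;
  rewrite ?inE ?eqxx ?wv //.
apply: IH; rewrite ?inE ?u0B 1?eq_sym ?vu0 //.
  by move: cardB; rewrite (cardsD1 v) vB.
move=> x; rewrite inE => /andP[xv xB] xu0.
have [y [yB eyx dyx ayx]] := parB _ xB xu0.
exists y; split=> //; rewrite !inE yB andbT.
apply: contraTneq dyx => ->; rewrite -leqNgt; apply: vmax.
by apply/setD1P.
Qed.

(** * Distance from a root and unions of geodesics *)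

Section Distance.
Variables (r : rel T) (u0 : T).

Fixpoint walk_of_length n v :=
  if n is m.+1 then [exists w, walk_of_length m w && r w v] else v == u0.

Lemma walk_of_lengthP v :
  reflect (exists n, walk_of_length n v) (connect r u0 v).
Proof.
apply: (iffP idP) => [/connectP[p]|[n]].
  elim/last_ind: p v => [|p x IH] v /=; first by move=> _ ->; exists 0 => /=.
  rewrite rcons_path last_rcons => /andP[rp rx] ->.
  have [n wn] := IH _ rp (erefl _).
  by exists n.+1; apply/existsP; exists (last u0 p); apply/andP.
elim: n v => [|n IH] v /= => [/eqP-> //|/existsP[w /andP[/IH cw rwv]]].
exact: connect_trans cw (connect1 rwv).
Qed.

(** [d] is the length of a shortest walk from [u0], with the default 0 at unreachable vertices. The
    last step of a shortest walk supplies the parent. *)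
Lemma distance_exists : exists d : T -> nat,
  (forall v, connect r u0 v -> v != u0 ->
     exists w, [/\ connect r u0 w, r w v & d v = (d w).+1]) /\
  (forall v w, connect r u0 v -> r v w -> d w <= (d v).+1).
Proof.
have shortest v : exists m, connect r u0 v ->
    walk_of_length m v /\ forall n, walk_of_length n v -> m <= n.
  case: (boolP (connect r u0 v)) => [|_]; last by exists 0.
  by case/walk_of_lengthP/ex_minnP => n wn nmin; exists n.
have [d dP] := fin_all_exists shortest.
have step v w : connect r u0 v -> r v w -> d w <= (d v).+1.
  move=> cv rvw; have [_] := dP _ (connect_trans cv (connect1 rvw)); apply.
  by apply/existsP; exists v; apply/andP; split; first exact: (dP _ cv).1.
exists d; split=> // v cv vu0; have [wv dv] := dP _ cv.
case dvE: (d v) wv => [|m] /=; first by rewrite (negbTE vu0).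
case/existsP=> w /andP[ww rwv]; have cw: connect r u0 w by apply/walk_of_lengthP; exists m.
exists w; split=> //; congr _.+1; apply/eqP; rewrite eqn_leq.
by rewrite -ltnS -dvE step //= (dP _ cw).2.
Qed.

Variable d : T -> nat.
Hypothesis parent_d : forall v, connect r u0 v -> v != u0 ->
  exists w, [/\ connect r u0 w, r w v & d v = (d w).+1].

(** Follow parents from [x] back to [u0]: [d] drops by one at each step, which makes it injective on
    the path. *)
Lemma geodesic_exists x : connect r u0 x -> exists P : {set T},
  [/\ u0 \in P, x \in P, {in P, forall v, connect r u0 v /\ d v <= d x},
      {in P &, injective d}
    & {in P, forall v, v != u0 -> exists w, [/\ w \in P, r w v & d v = (d w).+1]}].
Proof.
have [n] := ubnP (d x); elim: n x => // n IH x dx cx.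
have [xu0|xu0] := eqVneq x u0.
  exists [set x]; rewrite -xu0 !inE eqxx; split=> //.
  - by move=> v /set1P->; split.
  - by move=> v w /set1P-> /set1P->.
  - by move=> v /set1P->; rewrite eqxx.
have [w [cw rwx dxw]] := parent_d cx xu0.
have [|//|P [u0P wP bP injP parP]] := IH w; first by move: dx; rewrite dxw.
have xd v : v \in P -> d x <> d v.
  by move=> vP dxv; have := (bP _ vP).2; rewrite -dxv dxw ltnn.
exists (x |: P); split; rewrite ?inE ?u0P ?eqxx ?orbT //.
- move=> v /setU1P[->//|/bP[cv dv]]; split=> //.
  by rewrite dxw (leq_trans dv) // leqnSn.
- move=> v v' /setU1P[->|vP] /setU1P[->|v'P] // E; first by case: (xd _ v'P).
    by case: (xd _ vP).
  exact: injP.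
- move=> v /setU1P[->|vP] vu0; first by exists w; rewrite !inE wP orbT.
  by have [y [yP ryv dvy]] := parP _ vP vu0; exists y; rewrite !inE yP orbT.
Qed.

(** Each of the [k.+1] geodesics meets a distance layer at most once; this bound on the layers
    becomes the clustering constant. *)
Lemma geodesic_union k (x : 'I_k.+1 -> T) :
  (forall c, connect r u0 (x c)) -> exists A : {set T},
  [/\ u0 \in A, forall c, x c \in A, {in A, forall v, connect r u0 v},
      {in A, forall v, v != u0 -> exists w, [/\ w \in A, r w v & d v = (d w).+1]}
    & forall n, #|[set y in A | d y == n]| <= k.+1].
Proof.
move=> cx.
have [P PP] := fin_all_exists (fun c => geodesic_exists (cx c)).
have inA c v : v \in P c -> v \in \bigcup_c P c by move=> vP; apply/bigcupP; exists c.
exists (\bigcup_c P c); split.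
- by apply: (inA ord0); case: (PP ord0).
- by move=> c; apply: (inA c); case: (PP c).
- by move=> v /bigcupP[c _ vP]; case: (PP c) => _ _ /(_ _ vP)[].
- move=> v /bigcupP[c _ vP] vu0; case: (PP c) => _ _ _ _ /(_ _ vP vu0)[w [wP ? ?]].
  by exists w; split=> //; apply: inA wP.
move=> n; have -> : [set y in \bigcup_c P c | d y == n]
    = \bigcup_c [set y in P c | d y == n].
  apply/setP=> y; rewrite inE; apply/andP/bigcupP.
    by case=> /bigcupP[c _ yP] dy; exists c; rewrite // inE yP.
  by case=> c _; rewrite inE => /andP[yP dy]; split=> //; apply: inA yP.
rewrite [leqRHS](_ : _ = \sum_(c < k.+1) 1); last by rewrite sum_nat_const card_ord muln1.
apply: (big_ind2 (fun (S : {set T}) m => #|S| <= m)); first by rewrite cards0.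
  by move=> S m S' m' Sm S'm'; apply: leq_trans (leq_card_setU _ _) (leq_add Sm S'm').
move=> c _; apply/card_le1_eqP => v w; rewrite !inE => /andP[vP /eqP dv] /andP[wP /eqP dw].
by case: (PP c) => _ _ _ injP _; apply: injP; rewrite ?dv ?dw.
Qed.

End Distance.


(** * Saturated trees and the odd minor they form *)

(** The neighbours [v] and [w] carry both values, so [u] keeps a monochromatic edge to [B] whatever
    value it receives later. *)
Definition saturated (alpha : T -> bool) (B U : {set T}) :=
  forall u v, u \in U -> v \in B -> e u v ->
    exists w, [/\ w \in B, e u w & alpha w != alpha v].

Hypothesis e_irr : irreflexive e.

(** Unsaturated vertices are absorbed one at a time, which terminates because [U :\: A'] shrinks.
    Values change only on [U :\: A], so trees outside [U] are unaffected. *)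
Lemma saturated_extension alpha (A U : {set T}) :
  A \subset U -> bichromatic_tree alpha A ->
  exists (A' : {set T}) (beta : T -> bool),
    [/\ A \subset A' /\ A' \subset U,
        forall v, v \notin U :\: A -> beta v = alpha v,
        bichromatic_tree beta A',
        saturated beta A' (U :\: A')
      & forall x y, x \in A' -> y \in A' -> e x y -> beta x = beta y ->
          x \in A /\ y \in A].
Proof.
move=> AU tA.
suff grow n (A' : {set T}) (beta : T -> bool) : #|U :\: A'| < n -> A \subset A' ->
    A' \subset U -> (forall v, v \notin U :\: A -> beta v = alpha v) ->
    bichromatic_tree beta A' ->
    (forall x y, x \in A' -> y \in A' -> e x y -> beta x = beta y ->
          x \in A /\ y \in A) ->
    exists (A' : {set T}) (beta : T -> bool),
    [/\ A \subset A' /\ A' \subset U,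
        forall v, v \notin U :\: A -> beta v = alpha v,
        bichromatic_tree beta A',
        saturated beta A' (U :\: A')
      & forall x y, x \in A' -> y \in A' -> e x y -> beta x = beta y ->
          x \in A /\ y \in A].
  exact: (grow #|U :\: A|.+1 A alpha).
elim: n A' beta => // n IH A' beta cardA' AA' A'U eqba tA' monoA'.
case: (boolP [exists u in U :\: A', exists v in A',
    e u v && [forall w in A', e u w ==> (beta w == beta v)]]); last first.
  move=> sat; exists A', beta; split=> // u v uU vA' euv.
  have := exists_inPn sat _ uU => /exists_inPn/(_ _ vA').
  rewrite euv /= => /forall_inPn[w wA']; rewrite negb_imply => /andP[euw bwv].
  by exists w.
case/exists_inP=> u uUA' /exists_inP[v vA' /andP[euv /forall_inP unif]].
have [uU uA'] : u \in U /\ u \notin A' by move: uUA'; rewrite inE => /andP[].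
have uA : u \notin A by apply: contra uA'; apply: (subsetP AA').
(* All neighbours of [u] in [A'] have the value of [v]; the opposite value makes every edge from [u]
   to [A'] bichromatic, so [u] becomes a leaf. *)
pose gamma z := if z == u then ~~ beta v else beta z.
have gammaE z : z \in A' -> gamma z = beta z.
  by rewrite /gamma; case: eqP => // -> /idPn; rewrite uA'.
have gammau : gamma u = ~~ beta v by rewrite /gamma eqxx.
have bi w : w \in A' -> e u w -> gamma w != gamma u.
  move=> wA' euw; rewrite gammaE // gammau.
  by have /implyP/(_ euw)/eqP-> := unif _ wA'; case: (beta v).
apply: (IH (u |: A') gamma).
- apply: leq_trans (cardA' : _ <= n); apply: proper_card; apply/properP; split.
    by apply: setDS; apply: subsetUr.
  by exists u; rewrite // !inE eqxx.
- exact: subset_trans AA' (subsetUr _ _).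
- by rewrite subUset sub1set uU.
- move=> z zUA; rewrite -eqba // /gamma; case: eqP => // zu.
  by move: zUA; rewrite zu inE uA uU.
- apply: (@BichromaticLeaf _ _ v) => //; first by apply: eq_bichromatic_tree tA' => z /gammaE.
    by rewrite e_sym.
  exact: bi.
move=> x y /setU1P[->|xA'] /setU1P[->|yA'] exy.
- by rewrite e_irr in exy.
- by move=> E; have := bi _ yA' exy; rewrite E eqxx.
- by move=> E; rewrite e_sym in exy; have := bi _ xA' exy; rewrite E eqxx.
by rewrite !gammaE //; apply: monoA'.
Qed.

Lemma odd_complete_minor k alpha (V : 'I_k -> {set T}) :
  (forall c, bichromatic_tree alpha (V c)) ->
  (forall c c', c != c' -> [disjoint V c & V c']) ->
  (forall c c', c != c' -> exists x y,
     [/\ x \in V c, y \in V c', e x y & alpha x = alpha y]) ->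
  odd_minor e (complete_graph k).
Proof.
move=> tV disjV monoV.
have treeV c : exists E : rel T,
    tree_subgraph e (V c) E /\ forall x y, E x y -> alpha x != alpha y.
  by have [E ? ?] := bichromatic_tree_subgraph (tV c); exists E.
have [E EP] := fin_all_exists treeV.
by exists V, E, alpha; split=> // [c|c]; case: (EP c).
Qed.

(** * Inductive construction of the colouring *)

Section Decomposition.
Variable k : nat.
Hypothesis no_odd_minor : ~ odd_minor e (complete_graph k.+2).

(** An empty [B c] means that colour [c] has no tree at present; this lets the process start from
    nothing and reuse colours. *)
Definition odd_clique_state alpha (B : 'I_k.+1 -> {set T}) (U : {set T}) :=
  [/\ forall c, B c != set0 -> bichromatic_tree alpha (B c),
      forall c c', c != c' -> [disjoint B c & B c'],
      forall c c', c != c' -> B c != set0 -> B c' != set0 -> exists x y,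
        [/\ x \in B c, y \in B c', e x y & alpha x = alpha y],
      forall c, [disjoint B c & U]
    & forall c, saturated alpha (B c) U].

(* [P x] only has to contain the monochromatic component of [x] in [U],
   so that no connectivity argument is needed when pieces are glued. *)
Definition good_coloring (B : 'I_k.+1 -> {set T}) (U : {set T})
    (q : T -> 'I_k.+1) (alpha : T -> bool) (P : T -> {set T}) :=
  [/\ forall u v, u \in U -> v \in B (q u) -> ~~ e u v,
      forall x, x \in U -> x \in P x /\ #|P x| <= k.+1
    & forall x y, x \in U -> y \in U -> e x y -> q x = q y ->
        alpha x = alpha y -> P x = P y].

Lemma odd_clique_state_sub alpha B (U U' : {set T}) : U' \subset U ->
  odd_clique_state alpha B U -> odd_clique_state alpha B U'.
Proof.
move=> U'U [tB dB mB dU sB]; split=> // c; first exact: disjointWr U'U (dU c).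
by move=> u v /(subsetP U'U); apply: sB.
Qed.

Lemma good_coloring_split B (C U : {set T}) :
  {in C & U :\: C, forall x y, ~~ e x y} ->
  (exists q alpha P, good_coloring B C q alpha P) ->
  (exists q alpha P, good_coloring B (U :\: C) q alpha P) ->
  exists q alpha P, good_coloring B U q alpha P.
Proof.
move=> sepC [q [a [P [qB PP PE]]]] [q' [a' [P' [q'B P'P P'E]]]].
exists (fun x => if x \in C then q x else q' x),
  (fun x => if x \in C then a x else a' x),
  (fun x => if x \in C then P x else P' x).
have out x : x \in U -> x \notin C -> x \in U :\: C by rewrite inE => -> ->.
split.
- move=> u v uU; case: ifPn => uC; first exact: qB.
  by apply: q'B; apply: out.
- move=> x xU; case: ifPn => xC; first exact: PP.
  by apply: P'P; apply: out.
move=> x y xU yU exy; case: ifPn => xC; case: ifPn => yC.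
- exact: PE.
- by have := sepC _ _ xC (out _ yU yC); rewrite exy.
- by have := sepC _ _ yC (out _ xU xC); rewrite e_sym exy.
by apply: P'E => //; apply: out.
Qed.

(** Strong induction on the size of [U]. The clause of [good_coloring] forbidding edges to the tree
    of one's own colour is what keeps the new tree's monochromatic components apart from the rest of
    [U]. *)
Lemma good_coloring_exists alpha B (U : {set T}) :
  odd_clique_state alpha B U ->
  exists q beta P, good_coloring B U q beta P.
Proof.
have [n] := ubnP #|U|; elim: n alpha B U => // n IH alpha B U cardU st.
have [->|[u0 u0U]] := set_0Vmem U.
  exists (fun _ => ord0), alpha, (fun x => [set x]).
  by split=> [u v|x|x y]; rewrite !inE.
(* Distances are measured inside [U], and [C] is the component of [u0] there. If [C] is not all of
   [U], the two parts are coloured separately. *)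
pose r : rel T := fun x y => [&& e x y, x \in U & y \in U].
pose C := [set v | connect r u0 v].
have u0C : u0 \in C by rewrite inE connect0.
have CU : C \subset U.
  apply/subsetP => v; rewrite inE => /connectP[p + ->].
  by case/lastP: p => // p x; rewrite rcons_path last_rcons => /andP[_ /and3P[]].
case: (boolP (U \subset C)) => [UC|nUC]; last first.
  have pC : C \proper U by apply/properP; split=> //; apply/subsetPn.
  apply: (@good_coloring_split _ C).
  - move=> x y xC; rewrite inE => /andP[yC yU]; apply: contra yC => exy.
    have rxy : r x y by rewrite /r exy yU (subsetP CU).
    by move: xC; rewrite !inE => cx; apply: connect_trans cx (connect1 rxy).
  - apply: (IH alpha); last exact: odd_clique_state_sub st.
    by rewrite -ltnS; apply: leq_trans cardU; rewrite ltnS proper_card.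
  - apply: (IH alpha); last by apply: odd_clique_state_sub st; apply: subsetDl.
    rewrite -ltnS; apply: leq_trans cardU; rewrite ltnS proper_card //.
    apply/properP; split; first exact: subsetDl.
    by exists u0; rewrite // inE u0C.
have conn v : v \in U -> connect r u0 v by move=> /(subsetP UC); rewrite inE.
have {C u0C CU UC} inU v : connect r u0 v -> v \in U.
  by move=> cv; apply: (subsetP CU); rewrite inE.
have [tB dB mB dU sB] := st.
have [d [parent_d step_d]] := distance_exists r u0.
(* [J] collects the colours whose tree touches [U]. Other colours get [u0] as a dummy attachment
   vertex, so that geodesics exist for every colour. *)
pose J := [set c | [exists u in U, exists v in B c, e u v]].
have attach c : exists u, u \in U /\ (c \in J -> exists2 v, v \in B c & e u v).
  case: (boolP (c \in J)) => cJ; last by exists u0.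
  move: (cJ); rewrite inE => /exists_inP[u uU /exists_inP[v vB euv]].
  by exists u; split=> // _; exists v.
have [x xP] := fin_all_exists attach.
have [A [u0A xA Ac parA layer]] := geodesic_union parent_d (fun c => conn _ (xP c).1).
have AU : A \subset U by apply/subsetP => v /Ac/inU.
(* Parity of the distance makes parent edges bichromatic; outside [U] the existing trees keep their
   values. *)
pose alpha0 v := if v \in U then odd (d v) else alpha v.
have tA : bichromatic_tree alpha0 A.
  apply: (bichromatic_tree_of_parents (d := d)) u0A _ => v vA vu0.
  have [w [wA /and3P[ewv wU vU] dvw]] := parA _ vA vu0.
  exists w; split=> //; first by rewrite dvw.
  by rewrite /alpha0 wU vU dvw /=; case: odd.
have [A' [beta [[AA' A'U] betaE tA' satA' monoA']]] := saturated_extension AU tA.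
have betaB c v : v \in B c -> beta v = alpha v.
  move=> vB; have vU : v \notin U by apply: contraTN vB => vU; rewrite (disjointFl (dU c)).
  by rewrite betaE /alpha0 ?(negbTE vU) // inE (negbTE vU) andbF.
have JB c : c \in J -> B c != set0.
  by rewrite inE => /exists_inP[u _ /exists_inP[v vB _]]; apply/set0Pn; exists v.
have tBb c : c \in J -> bichromatic_tree beta (B c).
  by move=> cJ; apply: eq_bichromatic_tree (tB _ (JB _ cJ)) => v /betaB.
have monoBb c c' : c != c' -> c \in J -> c' \in J -> exists x y,
    [/\ x \in B c, y \in B c', e x y & beta x = beta y].
  move=> cc' cJ c'J; have [y [z [yB zB eyz ayz]]] := mB _ _ cc' (JB _ cJ) (JB _ c'J).
  by exists y, z; split; rewrite // (betaB _ _ yB) (betaB _ _ zB).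
(* By saturation of [B c], the vertex [x c] has neighbours of both values there, one of which agrees
   with [beta (x c)]. *)
have monoAB c : c \in J -> exists y z,
    [/\ y \in A', z \in B c, e y z & beta y = beta z].
  move=> cJ; have [xU /(_ cJ)[v vB exv]] := xP c.
  have xA' := subsetP AA' _ (xA c).
  have [w [wB exw awv]] := sB _ _ _ xU vB exv.
  have [bv|bv] := eqVneq (beta (x c)) (beta v); first by exists (x c), v.
  exists (x c), w; split=> //; rewrite (betaB _ _ vB) (betaB _ _ wB) in bv *.
  by move: awv bv; case: (alpha w) (alpha v) (beta _) => [] [] [].
have dAB c : [disjoint A' & B c].
  by rewrite disjoint_sym; apply: disjointWr A'U (dU c).
case: (boolP (J == setT)) => [/eqP JT|].
  case: no_odd_minor.
  have inJ c : c \in J by rewrite JT inE.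
  (* The index [ord_max] stands for the new tree [A'], and the other [k.+1] indices for the old
     trees. *)
  apply: (@odd_complete_minor _ beta
    (fun i => if unlift ord_max i is Some c then B c else A')).
  - by move=> i; case: unliftP => [c _|_] //; apply: tBb.
  - move=> i i'; case: unliftP => [c ->|->]; case: unliftP => [c' ->|->].
    + by rewrite (inj_eq lift_inj) => /dB.
    + by rewrite disjoint_sym.
    + by [].
    + by rewrite eqxx.
  move=> i i'; case: unliftP => [c ->|->]; case: unliftP => [c' ->|->].
  - by rewrite (inj_eq lift_inj) => cc'; apply: monoBb.
  - move=> _; have [y [z [yA zB eyz byz]]] := monoAB _ (inJ c).
    by exists z, y; split=> //; rewrite e_sym.
  - by move=> _; apply: monoAB.
  by rewrite eqxx.
rewrite -subTset => /subsetPn[c0 _ c0J].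
(* Trees that do not touch [U] are dropped: they constrain nothing in [U], and [A'] need not be
   joined to them. This frees [c0] for [A']. *)
pose B' c := if c == c0 then A' else if c \in J then B c else set0.
have [||q [gamma [P [qB PP PE]]]] := IH beta B' (U :\: A').
- rewrite -ltnS; apply: leq_trans cardU; rewrite ltnS proper_card //.
  apply/properP; split; first exact: subsetDl.
  by exists u0; rewrite // inE (subsetP AA').
- split.
  + move=> c; rewrite /B'; case: ifP => // _; case: ifP => [cJ _|]; last by rewrite eqxx.
    exact: tBb.
  + move=> c c' cc'; rewrite /B'; case: (eqVneq c c0) => [cc0|_]; case: (eqVneq c' c0) => [c'c0|_].
    * by rewrite cc0 c'c0 eqxx in cc'.
    * by case: ifP => // _; rewrite disjoint_sym -setI_eq0 set0I.
    * by case: ifP => [_|_]; rewrite disjoint_sym // -setI_eq0 setI0.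
    * by do 2!case: ifP => _; rewrite -setI_eq0 ?setI0 ?set0I // setI_eq0 dB.
  + move=> c c' cc'; rewrite /B'; case: (eqVneq c c0) => [cc0|_]; case: (eqVneq c' c0) => [c'c0|_].
    * by rewrite cc0 c'c0 eqxx in cc'.
    * by case: ifP => [c'J _ _|]; [apply: monoAB|rewrite eqxx].
    * case: ifP => [cJ _ _|]; last by rewrite eqxx.
      have [y [z [yA zB eyz byz]]] := monoAB _ cJ.
      by exists z, y; split=> //; rewrite e_sym.
    * case: ifP => [cJ _|]; last by rewrite eqxx.
      by case: ifP => [c'J _|]; [apply: monoBb|rewrite eqxx].
  + move=> c; rewrite /B'; case: ifP => _; first by rewrite disjoint_sym disjoints_subset setDE subsetIr.
    case: ifP => _; last by rewrite -setI_eq0 set0I.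
    by apply: disjointWr (dU c); apply: subsetDl.
  + move=> c; rewrite /B'; case: ifP => // _; case: ifP => _ u v; last by rewrite !inE.
    rewrite inE => /andP[_ uU] vB euv.
    have [w [wB euw awv]] := sB _ _ _ uU vB euv.
    by exists w; split; rewrite // (betaB _ _ vB) (betaB _ _ wB).
(* On [A] the bounding set is the distance layer; an absorbed vertex has no monochromatic edge
   within [A'], so a singleton suffices. *)
exists (fun y => if y \in A' then c0 else q y),
  (fun y => if y \in A' then beta y else gamma y),
  (fun y => if y \in A then [set z in A | d z == d y]
            else if y \in A' then [set y] else P y).
have out y : y \in U -> y \notin A' -> y \in U :\: A' by rewrite inE => -> ->.
have Bq u v : u \in U -> v \in B (q u) -> e u v -> q u != c0 -> v \in B' (q u).
  move=> uU vB euv qc0; rewrite /B' (negbTE qc0) (_ : q u \in J) //.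
  by rewrite inE; apply/exists_inP; exists u => //; apply/exists_inP; exists v.
(* Since [A'] is the tree of colour [c0] in [B'], its neighbours in the rest of [U] avoid [c0], so
   no edge leaving [A'] within [U] joins equal colours. *)
have sepA u v : u \in U -> u \notin A' -> v \in A' -> e u v -> q u != c0.
  move=> uU uA' vA' euv; apply/eqP => qc0.
  by have := qB u v (out _ uU uA'); rewrite qc0 /B' eqxx euv => /(_ vA').
split.
- move=> u v uU; case: ifPn => uA' vB.
    apply: contra c0J => euv; rewrite inE; apply/exists_inP; exists u => //.
    by apply/exists_inP; exists v.
  apply/negP => euv; have [qc0|qc0] := eqVneq (q u) c0.
    move: c0J; rewrite inE -qc0 => /exists_inP[]; exists u => //.
    by apply/exists_inP; exists v.
  by have := qB u v (out _ uU uA') (Bq _ _ uU vB euv qc0); rewrite euv.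
- move=> y yU; case: ifPn => yA; first by rewrite inE yA eqxx layer.
  case: ifPn => yA'; first by rewrite set11 cards1.
  exact/PP/out.
move=> y z yU zU eyz.
have dle v w : v \in U -> w \in U -> e v w -> d w <= (d v).+1.
  by move=> vU wU evw; apply: step_d; [apply: conn|rewrite /r evw vU].
case: (boolP (y \in A')) => yA'; case: (boolP (z \in A')) => zA'.
(* Along an edge the distances differ by at most one, so equal parity forces the same layer. *)
- move=> _ byz; have [yA zA] := monoA' _ _ yA' zA' eyz byz.
  rewrite yA zA; suff -> : d y = d z by []; move: byz.
  rewrite !betaE ?inE ?yA ?zA // /alpha0 yU zU => oyz.
  have := dle _ _ yU zU eyz; rewrite leq_eqVlt => /orP[/eqP dz|].
    by move: oyz; rewrite dz /=; case: odd.
  rewrite e_sym in eyz.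
  have := dle _ _ zU yU eyz; rewrite leq_eqVlt => /orP[/eqP dy|].
    by move: oyz; rewrite dy /=; case: odd.
  by rewrite !ltnS => yz zy; apply/eqP; rewrite eqn_leq yz zy.
- by move=> qc0; rewrite e_sym in eyz; have := sepA _ _ zU zA' yA' eyz; rewrite -qc0 eqxx.
- by move=> qc0; have := sepA _ _ yU yA' zA' eyz; rewrite qc0 eqxx.
have nA v : v \notin A' -> v \in A = false.
  by move=> vA'; apply: contraNF vA'; apply: (subsetP AA').
rewrite (nA _ yA') (nA _ zA'); apply: PE => //; exact: out.
Qed.

End Decomposition.
End OddMinorColoring.

(** * The clustered colouring of the whole graph *)

Unset Implicit Arguments.

Theorem mainTheorem2 (t : nat) (ht : 2 <= t) :
  exists M : nat,
    forall (T : finType) (e : rel T),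
      simple_graph e ->
      ~ odd_minor e (complete_graph t) ->
      colorable_with_clustering e (10 * t - 13) M.
Proof.
(* With [t = k.+2], the clustering constant is [t - 1]. The initial state has no trees and all
   vertices uncoloured. *)
case: t ht => [|[|k]] // _; exists k.+1 => T e [e_sym e_irr] nominor.
have [|q [alpha [P [_ PP PE]]]] :=
    @good_coloring_exists T e e_sym e_irr k nominor (fun _ => false) (fun _ => set0) setT.
  by split=> [c|c c' _|c c' _|c|c u v]; rewrite ?eqxx ?inE // -setI_eq0 set0I.
have cardK : #|{: 'I_k.+1 * bool}| <= 10 * k.+2 - 13.
  rewrite card_prod card_ord card_bool 2!(mulnS 10) addnA -addnBAC //.
  by rewrite mulSn (mulnC k) leq_add // leq_mul2r orbT.
pose f x := widen_ord cardK (enum_rank (q x, alpha x)).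
have f_inj x y : f x = f y -> q x = q y /\ alpha x = alpha y.
  by move/(congr1 (@nat_of_ord _))/(@ord_inj _ (enum_rank _) (enum_rank _))/enum_rank_inj => -[-> ->].
exists f => x; have [xP] := PP x (in_setT x); apply: leq_trans.
apply: subset_leq_card; apply/subsetP => y; rewrite inE => cxy.
(* [P] is constant along monochromatic edges, so the whole component of [x] lies in [P x]. *)
suff <- : P y = P x by case: (PP y (in_setT y)).
case/connectP: cxy => p + ->.
elim/last_ind: p => //= p z IH; rewrite rcons_path last_rcons.
case/andP=> /IH <- /and3P[ewz /eqP fw /eqP fz].
have [qwz awz] : q (last x p) = q z /\ alpha (last x p) = alpha z.
  by apply: f_inj; rewrite fw fz.
by rewrite (PE _ _ (in_setT _) (in_setT _) ewz qwz awz).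
Qed.
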